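(* The expected rumor spreading time of the pull protocol on the complete graph with $n$ vertices is $\log_2 n+\log_2\ln n\pm O(1)$.
   Context: Pull protocol on the complete graph with $n$ nodes: initially exactly one node is informed. In each round, every node that is uninformed at the beginning of the round calls a node chosen independently and uniformly at random from all $n$ nodes (including itself); if the called node was informed at the beginning of the round, the caller is informed from the end of that round on. The rumor spreading time is the number of rounds until all nodes are informed. $\pm O(1)$ denotes a deviation bounded in absolute value by a constant independent of $n$, for all sufficiently large $n$. *)

(* Defs.v *)
(* MathComp-Analysis *)
From HB Require Import structures.
From mathcomp Require Import all_boot all_order all_algebra.
From mathcomp Require Import all_classical all_reals all_analysis.

Set Implicit Arguments.
Unset Strict Implicit.
Unset Printing Implicit Defensive.

Import Order.TTheory GRing.Theory Num.Theory.

Local Open Scope classical_set_scope.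
Local Open Scope ring_scope.

Definition log2 (R : realType) (x : R) : R := ln x / ln 2.

(* [call t v] is the node called by [v] in round [t] (rounds are numbered from
   0). Only the calls of uninformed nodes matter: the value of [call t v] is
   irrelevant if [v] is already informed at the beginning of round [t].
   [informed v0 call t] is the set of nodes informed after [t] rounds. *)
Fixpoint informed (n : nat) (v0 : 'I_n) (call : nat -> 'I_n -> 'I_n) (t : nat)
    : {set 'I_n} :=
  if t is s.+1 then
    let I := informed v0 call s in
    [set v : 'I_n | (v \in I) || (call s v \in I)]%SET
  else [set v0]%SET.

(* The value is +oo if some node is never informed. *)
Definition spreading_time (R : realType) (n : nat) (v0 : 'I_n)
    (call : nat -> 'I_n -> 'I_n) : \bar R :=
  ereal_inf [set (t%:R)%:E | t in
    [set t : nat | informed v0 call t = [set: 'I_n]%SET]].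

(* Discrete random variables: the finite type [V] carries the full
   sigma-algebra. *)
Definition discrete_rv (d : measure_display) (Omega : measurableType d)
    (V : finType) (X : Omega -> V) : Prop :=
  forall A : {set V}, measurable [set w | X w \in A].

Definition uniform_rv (d : measure_display) (Omega : measurableType d)
    (R : realType) (P : probability Omega R) (V : finType) (X : Omega -> V)
    : Prop :=
  forall u : V, P [set w | X w = u] = ((#|V|%:R)^-1)%:E.

Definition mutually_independent (d : measure_display)
    (Omega : measurableType d) (R : realType) (P : probability Omega R)
    (K : eqType) (V : finType) (X : K -> Omega -> V) : Prop :=
  forall (J : seq K) (A : K -> {set V}), uniq J ->
    P [set w | forall k, k \in J -> X k w \in A k] =
    (\prod_(k <- J) P [set w | X k w \in A k])%E.

Definition pull_calls (d : measure_display) (Omega : measurableType d)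
    (R : realType) (P : probability Omega R) (n : nat)
    (call : nat -> 'I_n -> Omega -> 'I_n) : Prop :=
  [/\ forall t v, discrete_rv (call t v),
      forall t v, uniform_rv P (call t v) &
      mutually_independent P (fun k : nat * 'I_n => call k.1 k.2)].

(* Main.v *)
Require Import Defs.
From HB Require Import structures.
From mathcomp Require Import all_boot all_order all_algebra.
From mathcomp Require Import all_classical all_reals all_analysis.
From mathcomp Require Import measurable_realfun.
From mathcomp Require Import ring lra zify.

Import Order.TTheory GRing.Theory Num.Theory.

Local Open Scope classical_set_scope.
Local Open Scope ring_scope.

(* The informed sets form a Markov chain with one-round expectation operator
   [pull_mean]. With u uninformed nodes, the next number of uninformed nodes has
   mean m = u^2/n and variance at most m. The expected spreading time is the sum
   over t of P(some node is uninformed after t rounds).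

   Upper bound: a nonnegative potential that drops by at least 1 in the mean per
   round bounds this sum by its initial value. For i informed nodes it is
   essentially log2(n/i) + log2(ln n) - log2(ln(n/u)), where the last part
   is frozen until u <= n/16: then it is a concave function of u, and its drift
   follows from the value of the mean of u alone.

   Lower bound: by Chebyshev's inequality u^2/(2n) is a lower bound for the next
   u with high probability, so k further rounds from u >= n/2 finish with
   probability at most k 4^(2^k)/n; and since the mean number of informed nodes
   at most doubles, u >= n/2 fails after s rounds with probability at most
   2^(s+1)/n. Take s up to log2 n and k about log2(ln n). *)

(** * Expectations along the process *)

Definition pull_step {n : nat} (S : {set 'I_n}) (c : 'I_n -> 'I_n) : {set 'I_n} :=
  [set v : 'I_n | (v \in S) || (c v \in S)]%SET.

(** The average is over the calls of all nodes. Those of informed nodes do not affect [pull_step],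
    and including them makes the weight the same for every [S]. *)
Definition pull_mean {R : realType} {n : nat} (f : {set 'I_n} -> R)
    (S : {set 'I_n}) : R :=
  (\sum_(c : {ffun 'I_n -> 'I_n}) f (pull_step S c)) / (n ^ n)%:R.

Section pull_mean_theory.
Context {R : realType} {n : nat}.
Hypothesis n_gt0 : (0 < n)%N.
Implicit Types (f g : {set 'I_n} -> R) (S : {set 'I_n}).

Local Notation uninf S := (#|~: S|%:R : R).

Let ncalls_neq0 : (n ^ n)%:R != 0 :> R.
Proof. by rewrite pnatr_eq0 -lt0n expn_gt0 n_gt0. Qed.

Lemma sub_pull_step S c : S \subset pull_step S c.
Proof. by apply/fintype.subsetP => v vS; rewrite inE vS. Qed.

Lemma eq_pull_mean f g S : f =1 g -> pull_mean f S = pull_mean g S.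
Proof. by move=> fg; congr (_ / _); apply: eq_bigr => c _; rewrite fg. Qed.

Lemma le_pull_mean f g S :
  (forall S', S \subset S' -> f S' <= g S') -> pull_mean f S <= pull_mean g S.
Proof.
move=> fg; rewrite ler_wpM2r ?invr_ge0//.
by apply: ler_sum => c _; apply/fg/sub_pull_step.
Qed.

Lemma pull_mean_cst (a : R) S : pull_mean (fun=> a) S = a.
Proof.
rewrite /pull_mean sumr_const card_ffun !card_ord -[a *+ _]mulr_natr.
by rewrite -mulrA divff ?mulr1.
Qed.

Lemma pull_meanD f g S :
  pull_mean (fun S' => f S' + g S') S = pull_mean f S + pull_mean g S.
Proof. by rewrite /pull_mean big_split/= mulrDl. Qed.

Lemma pull_meanZ (a : R) f S :
  pull_mean (fun S' => a * f S') S = a * pull_mean f S.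
Proof. by rewrite /pull_mean -mulr_sumr mulrA. Qed.

(** The calls are independent, so the average of the product factors over the nodes; a node outside
    [W] contributes [n / n]. Sets [W] of one and two nodes give the first two moments. *)
Lemma mean_calls_in (W A : {set 'I_n}) :
  (\sum_(c : {ffun 'I_n -> 'I_n}) \prod_(v in W) (c v \in A)%:R) / (n ^ n)%:R
  = (#|A|%:R / n%:R) ^+ #|W| :> R.
Proof.
transitivity (((\prod_(v : 'I_n) \sum_(u : 'I_n)
    (if v \in W then (u \in A)%:R else 1)) / (n ^ n)%:R) : R).
  congr (_ / _); rewrite bigA_distr_bigA/=; apply: eq_bigr => c _.
  by rewrite big_mkcond.
transitivity ((\prod_(v : 'I_n) (if v \in W then #|A|%:R else n%:R)) / (n ^ n)%:R : R).
  congr (_ / _); apply: eq_bigr => v _; case: ifP => _.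
    rewrite -sum1_card natr_sum [RHS]big_mkcond/=.
    by apply: eq_bigr => u _; case: ifP.
  by rewrite sumr_const card_ord.
have -> : (n ^ n)%:R = \prod_(v : 'I_n) n%:R :> R.
  by rewrite prodr_const card_ord natrX.
rewrite -prodf_div -prodr_const [RHS]big_mkcond/=; apply: eq_bigr => v _.
by case: ifP => // _; rewrite divff// pnatr_eq0 -lt0n.
Qed.

Lemma uninf_pull_step S (c : 'I_n -> 'I_n) :
  uninf (pull_step S c) = \sum_(v in ~: S) (c v \in ~: S)%:R.
Proof.
rewrite -sum1_card natr_sum big_mkcond [RHS]big_mkcond/=.
apply: eq_bigr => v _; rewrite !inE negb_or.
by case: (v \in S) (c v \in S) => [] [].
Qed.

Lemma pull_mean_uninf S :
  pull_mean (fun S' => uninf S') S = uninf S * (uninf S / n%:R).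
Proof.
rewrite /pull_mean; under eq_bigr do rewrite uninf_pull_step.
rewrite exchange_big/= mulr_suml (eq_bigr (fun=> uninf S / n%:R)).
  by rewrite sumr_const -[LHS]mulr_natl.
move=> v _; have := mean_calls_in [set v]%SET (~: S)%SET.
rewrite cards1 expr1 => <-; congr (_ / _).
by apply: eq_bigr => c _; rewrite big_set1.
Qed.

(** The square is a sum over ordered pairs of uninformed nodes: a diagonal pair contributes [p], any
    other pair [p ^+ 2]. *)
Lemma pull_mean_uninf2 S :
  pull_mean (fun S' => uninf S' ^+ 2) S =
  uninf S * (uninf S / n%:R)
  + uninf S * (uninf S - 1) * (uninf S / n%:R) ^+ 2.
Proof.
set p := uninf S / n%:R.
transitivity (\sum_(v in ~: S) \sum_(w in ~: S) (if w == v then p else p ^+ 2)).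
  rewrite /pull_mean; under eq_bigr do
    rewrite uninf_pull_step expr2 mulr_suml.
  rewrite exchange_big/= mulr_suml; apply: eq_bigr => v vS.
  under eq_bigr do rewrite mulr_sumr.
  rewrite exchange_big/= mulr_suml; apply: eq_bigr => w wS.
  have [<-|wv] := eqVneq.
    have := mean_calls_in [set w]%SET (~: S)%SET.
    rewrite cards1 expr1 -/p => <-; congr (_ / _); apply: eq_bigr => c _.
    by rewrite big_set1 -natrM mulnb andbb.
  have := mean_calls_in [set v; w]%SET (~: S)%SET.
  rewrite cards2 eq_sym wv -/p => <-; congr (_ / _); apply: eq_bigr => c _.
  by rewrite big_setU1 ?big_set1// inE eq_sym.
rewrite (eq_bigr (fun=> p + (uninf S - 1) * p ^+ 2)).
  by rewrite sumr_const -[LHS]mulr_natl; ring.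
move=> v vS; rewrite (bigD1 v)//= eqxx; congr (_ + _).
rewrite (eq_bigr (fun=> p ^+ 2)); last by move=> w /andP[_ /negbTE ->].
rewrite sumr_const -[LHS]mulr_natl [in RHS](cardD1 v) vS natrD addrAC subrr add0r.
by congr (_%:R * _); apply: eq_card => w; rewrite [LHS]unfold_in !inE andbC.
Qed.

Lemma pull_mean_quad (a b e : R) S :
  pull_mean (fun S' => a + b * uninf S' + e * uninf S' ^+ 2) S =
  a + b * (uninf S * (uninf S / n%:R))
    + e * (uninf S * (uninf S / n%:R)
           + uninf S * (uninf S - 1) * (uninf S / n%:R) ^+ 2).
Proof.
by rewrite 2!pull_meanD !pull_meanZ pull_mean_cst pull_mean_uninf
           pull_mean_uninf2.
Qed.

Lemma uninfE S : uninf S = n%:R - #|S|%:R.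
Proof. by rewrite -[in n%:R](card_ord n) -(cardsC S) natrD addrAC subrr add0r. Qed.

Definition mean_after (t : nat) f : {set 'I_n} -> R := iter t pull_mean f.

(** Unfolding [mean_after] conditions on the first round; this form splits off the last one. *)
Lemma mean_afterS t f S :
  mean_after t.+1 f S = mean_after t (pull_mean f) S.
Proof. by rewrite /mean_after iterSr. Qed.

Lemma le_mean_after t f g S :
  (forall S', S \subset S' -> f S' <= g S') ->
  mean_after t f S <= mean_after t g S.
Proof.
elim: t S => [|t IH] S fg /=; first exact: fg.
apply: le_pull_mean => S' SS'; apply: IH => S'' S'S''.
exact/fg/(fintype.subset_trans SS').
Qed.

Lemma eq_mean_after t f g S : f =1 g -> mean_after t f S = mean_after t g S.
Proof. by move=> fg; elim: t S => //= t IH S; exact: eq_pull_mean. Qed.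

Lemma mean_after_cst t (a : R) S : mean_after t (fun=> a) S = a.
Proof.
elim: t S => //= t IH S.
by rewrite (eq_pull_mean _ (fun=> a)) ?pull_mean_cst.
Qed.

Lemma mean_afterD t f g S :
  mean_after t (fun S' => f S' + g S') S = mean_after t f S + mean_after t g S.
Proof.
elim: t S => //= t IH S.
by rewrite (eq_pull_mean _ _ _ IH) pull_meanD.
Qed.

Lemma mean_afterZ t (a : R) f S :
  mean_after t (fun S' => a * f S') S = a * mean_after t f S.
Proof.
elim: t S => //= t IH S.
by rewrite (eq_pull_mean _ _ _ IH) pull_meanZ.
Qed.

End pull_mean_theory.

Lemma pull_mean_sum {R : realType} {n : nat} (I : finType)
    (g : I -> {set 'I_n} -> R) (S : {set 'I_n}) :
  pull_mean (fun S' => \sum_i g i S') S = \sum_i pull_mean (g i) S.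
Proof. by rewrite /pull_mean exchange_big/= mulr_suml. Qed.

Lemma mean_after_sum {R : realType} {n : nat} t (I : finType)
    (g : I -> {set 'I_n} -> R) (S : {set 'I_n}) :
  mean_after t (fun S' => \sum_i g i S') S = \sum_i mean_after t (g i) S.
Proof.
elim: t S => //= t IH S.
by rewrite (eq_pull_mean _ _ _ IH) pull_mean_sum.
Qed.

(** * From the probability space to the Markov chain *)

Section discrete_random_variables.
Context {d : measure_display} {Omega : measurableType d}.

Lemma discrete_rvP (V : finType) (X : Omega -> V) :
  (forall u, measurable [set w | X w = u]) -> discrete_rv X.
Proof.
move=> mX A.
have -> : [set w | X w \in A] = \bigcup_(u in [set` A]) [set w | X w = u].
  by apply/seteqP; split => [w XA|w [u uA /= ->]//]; exists (X w).
by apply: fin_bigcup_measurable => //; exact: finite_finset.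
Qed.

Lemma discrete_rv_comp (V W : finType) (f : V -> W) (X : Omega -> V) :
  discrete_rv X -> discrete_rv (f \o X).
Proof.
move=> mX; apply: discrete_rvP => u.
rewrite (_ : [set w | _] = [set w | X w \in [set v | f v == u]%SET])//.
by apply/seteqP; split=> w /=; rewrite inE => /eqP.
Qed.

Lemma discrete_rv_eq (V : finType) (X : Omega -> V) u :
  discrete_rv X -> measurable [set w | X w = u].
Proof.
move=> /(_ [set u]%SET); rewrite (_ : [set w | _] = [set w | X w = u])//.
by apply/seteqP; split => w /=; rewrite inE => /eqP.
Qed.

Lemma discrete_rv_pair (V W : finType) (X : Omega -> V) (Y : Omega -> W) :
  discrete_rv X -> discrete_rv Y -> discrete_rv (fun w => (X w, Y w)).
Proof.
move=> mX mY; apply: discrete_rvP => -[u v].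
rewrite (_ : [set w | _] = [set w | X w = u] `&` [set w | Y w = v]).
  by apply: measurableI; exact: discrete_rv_eq.
by apply/seteqP; split => w /= [-> ->].
Qed.

Lemma discrete_rv_ffun (I V : finType) (X : I -> Omega -> V) :
  (forall i, discrete_rv (X i)) -> discrete_rv (fun w => [ffun i => X i w]).
Proof.
move=> mX; apply: discrete_rvP => f.
rewrite (_ : [set w | _] = \bigcap_(i in [set: I]) [set w | X i w = f i]).
  apply: fin_bigcap_measurable; first exact: finite_finset.
  by move=> i _; exact: discrete_rv_eq.
apply/seteqP; split => w /= => [<- i _ /=|Xf]; first by rewrite ffunE.
by apply/ffunP => i; rewrite ffunE Xf.
Qed.

Lemma measure_partition {R : realType} (P : probability Omega R)
    (V : finType) (X : Omega -> V) (E : set Omega) :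
  discrete_rv X -> measurable E ->
  (P E = \sum_(u : V) P (E `&` [set w | X w = u]))%E.
Proof.
move=> mX mE.
rewrite [in LHS](_ : E = \bigcup_(u in [set: V]) (E `&` [set w | X w = u])).
  rewrite measure_fin_bigcup /=; last 3 first.
  - exact: finite_finset.
  - by move=> u v _ _ [w [[_ /= <-] [_ /= <-]]].
  - by move=> u _; apply: measurableI => //; exact: discrete_rv_eq.
  rewrite -big_enum/= [RHS]fsbig_seq ?enum_uniq//.
  rewrite (_ : [set` enum V] = setT)//.
  by apply/seteqP; split => u //= _; rewrite mem_enum.
by apply/seteqP; split => [w Ew|w [u _ []]//]; exists (X w).
Qed.

End discrete_random_variables.

Section pull_process.
Context {d : measure_display} {Omega : measurableType d} {R : realType}.
Context {P : probability Omega R} {n : nat} {v0 : 'I_n}.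
Context {call : nat -> 'I_n -> Omega -> 'I_n}.
Hypothesis calls : pull_calls P call.

Let n_gt0 : (0 < n)%N := leq_ltn_trans (leq0n v0) (ltn_ord v0).

Local Notation inf t w := (informed v0 (fun s v => call s v w) t).

Let calls_at t w : {ffun 'I_n -> 'I_n} := [ffun v => call t v w].

Lemma informedS t w : inf t.+1 w = pull_step (inf t w) (calls_at t w).
Proof. by apply/setP => v; rewrite !inE ffunE. Qed.

Let discrete_calls_at t : discrete_rv (calls_at t).
Proof. by case: calls => mcall _ _; exact: discrete_rv_ffun. Qed.

Lemma discrete_informed t : discrete_rv (fun w => inf t w).
Proof.
elim: t => [|t IH].
  move=> A /=; have [v0A|v0A] := boolP ([set v0]%SET \in A).
    by rewrite (_ : [set w | _] = setT)//; apply/seteqP; split.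
  by rewrite (_ : [set w | _] = set0)//; apply/seteqP; split => w //=; apply/negP.
rewrite (_ : (fun w => _) = (fun p : {set 'I_n} * {ffun 'I_n -> 'I_n} =>
    pull_step p.1 p.2) \o (fun w => (inf t w, calls_at t w))).
  by apply: discrete_rv_comp; apply: discrete_rv_pair.
by apply/funext => w; exact: informedS.
Qed.

Let later (J : seq (nat * 'I_n)) (A : nat * 'I_n -> {set 'I_n}) : set Omega :=
  [set w | forall k, k \in J -> call k.1 k.2 w \in A k].

Let measurable_later J A : measurable (later J A).
Proof.
case: calls => mcall _ _.
rewrite (_ : later J A =
    \bigcap_(k in [set` J]) [set w | call k.1 k.2 w \in A k]).
  by apply: fin_bigcap_measurable; [exact: finite_seq|move=> k _; exact: mcall].
by apply/seteqP; split => w /= H k; exact: H.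
Qed.

Let round (t : nat) : seq (nat * 'I_n) := [seq (t, v) | v : 'I_n].

(** The informed set after [t] rounds depends only on earlier calls. Carrying the event [later J A]
    along makes the induction work: in its step, the calls of round [t] move from the informed set
    into the list. *)
Lemma informed_independent t (B : {set {set 'I_n}}) J A :
  uniq J -> (forall k, k \in J -> (t <= k.1)%N) ->
  P ([set w | inf t w \in B] `&` later J A) =
  ((mean_after t (fun S => (S \in B)%:R) [set v0]%SET)%:E *
   \prod_(k <- J) P [set w | call k.1 k.2 w \in A k])%E.
Proof.
case: (calls) => mcall ucall icall.
elim: t B J A => [|t IH] B J A uJ tJ.
  rewrite -(icall J A uJ) /=; have [v0B|v0B] := boolP ([set v0]%SET \in B).
    rewrite (_ : [set w | _] = setT) ?setTI ?mul1e//.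
    by apply/seteqP; split.
  rewrite (_ : [set w | _] = set0) ?set0I ?measure0 ?mul0e//.
  by apply/seteqP; split => w //=; apply/negP.
have mE : measurable ([set w | inf t.+1 w \in B] `&` later J A).
  by apply: measurableI => //; exact: discrete_informed.
rewrite (measure_partition P _ _ _ (discrete_calls_at t) mE).
transitivity (\sum_(c : {ffun 'I_n -> 'I_n})
  ((mean_after t (fun S => (pull_step S c \in B)%:R / (n ^ n)%:R) [set v0]%SET)%:E *
   \prod_(k <- J) P [set w | call k.1 k.2 w \in A k]))%E; last first.
  rewrite -ge0_sume_distrl => [|c _]; last first.
    rewrite lee_fin -[leLHS](mean_after_cst n_gt0 t 0 [set v0]%SET).
    by apply: le_mean_after => S' _; rewrite divr_ge0.
  rewrite sumEFin -mean_after_sum mean_afterS; congr (_%:E * _)%E.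
  by apply: eq_mean_after => S; rewrite /pull_mean mulr_suml.
apply: eq_bigr => c _.
(* That round [t] has the calls [c] is again an event of the form [later]: all pairs [(t, v)] join
   the list, with the singleton of [c v] as target set. *)
pose A' k := if k.1 == t then [set c k.2]%SET else A k.
have eA' k : k \in J -> A' k = A k.
  by rewrite /A'; case: eqP => // kt /tJ; rewrite kt ltnn.
pose B' := [set S | pull_step S c \in B]%SET.
have uJ' : uniq (round t ++ J).
  rewrite cat_uniq uJ andbT map_inj_uniq ?enum_uniq; last by move=> u v [].
  apply/hasPn => k /tJ; apply: contraTN => /mapP[v _ ->].
  by rewrite -leqNgt.
have := IH B' (round t ++ J) A' uJ'.
rewrite big_cat/=.
rewrite (_ : _ `&` _ = [set w | inf t.+1 w \in B] `&` later J A `&` [set w | calls_at t w = c]); last first.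
  apply/seteqP; split => w.
    move=> [/= + H]; rewrite inE => BS.
    have cE : calls_at t w = c.
      apply/ffunP => v; rewrite ffunE; have := H (t, v).
      rewrite mem_cat map_f ?mem_enum// => /(_ isT).
      by rewrite /A' eqxx inE => /eqP.
    split => //; split; first by change (inf t.+1 w \in B); rewrite informedS cE.
    by move=> k kJ; rewrite -eA'// H// mem_cat kJ orbT.
  move=> [[BS H] cE]; split; first by rewrite /mkset inE -cE -(informedS t w).
  move=> k; rewrite mem_cat => /orP[/mapP[v _ ->]|kJ].
    by rewrite /A' eqxx inE -cE ffunE.
  by rewrite eA'// H.
move=> ->; last first.
  move=> k; rewrite mem_cat => /orP[/mapP[v _ ->]//|/tJ]; exact: ltnW.
rewrite muleA; congr (_ * _)%E; last first.
  by rewrite !big_seq; apply: eq_bigr => k /eA' ->.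
(* The [n] calls of round [t] contribute [n%:R^-1] each, together the weight in [pull_mean]. *)
rewrite big_map big_enum/=.
rewrite (eq_bigr (fun=> (n%:R^-1)%:E)) => [|v _]; last first.
  have := ucall t v (c v); rewrite card_ord => <-; congr (P _).
  by apply/seteqP; split => w /=; rewrite /A' eqxx inE => /eqP.
rewrite prodEFin -EFinM prodr_const card_ord exprVn natrX mulrC -mean_afterZ.
congr _%:E; apply: eq_mean_after => S.
by rewrite /B' inE mulrC.
Qed.

Lemma prob_informed t (B : {set {set 'I_n}}) :
  P [set w | inf t w \in B] =
  (mean_after t (fun S => (S \in B)%:R) [set v0]%SET)%:E.
Proof.
have := informed_independent t B [::] (fun=> finset.set0) isT.
rewrite big_nil mule1 => <- //; congr (P _).
by apply/seteqP; split => w // [].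
Qed.

Lemma sub_informed w s t : (s <= t)%N -> inf s w \subset inf t w.
Proof.
move=> /subnK <-; elim: (t - s)%N => [|k IH]; first exact: fintype.subxx.
apply: (fintype.subset_trans IH).
by rewrite addSn informedS; exact: sub_pull_step.
Qed.

(** Informed sets only grow, so the incomplete times are exactly those before the first complete
    one. If there is no complete time, both sides are [+oo]. *)
Lemma spreading_timeE w :
  spreading_time R v0 (fun t v => call t v w) =
  (\sum_(0 <= t <oo) ((inf t w != [set: 'I_n]%SET)%:R)%:E)%E.
Proof.
have t_ge0 t : (0 <= ((inf t w != [set: 'I_n]%SET)%:R)%:E :> \bar R)%E.
  by rewrite lee_fin.
apply/eqP; rewrite eq_le; apply/andP; split; last first.
  apply: lime_le; first exact: is_cvg_nneseries.
  apply: nearW => N; apply: le_ereal_inf_tmp => _ [t tfull <-].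
  rewrite sumEFin lee_fin -natr_sum ler_nat.
  have full s : (t <= s)%N -> inf s w = [set: 'I_n]%SET.
    by move=> /(sub_informed w); rewrite tfull finset.subTset => /eqP.
  have [Nt|tN] := leqP N t.
    apply: (leq_trans _ Nt); rewrite -[leqRHS]subn0 -[leqRHS]muln1 -sum_nat_const_nat.
    by apply: leq_sum => s _; exact: leq_b1.
  rewrite (big_cat_nat (leq0n t) (ltnW tN))/= [X in (_ + X)%N]big_nat_cond.
  rewrite [X in (_ + X)%N]big1 ?addn0; last first.
    by move=> s /andP[/andP[/full -> _] _]; rewrite eqxx.
  rewrite -[leqRHS]subn0 -[leqRHS]muln1 -sum_nat_const_nat.
  by apply: leq_sum => s _; exact: leq_b1.
have [[t tfull]|nofull] := pselect (exists t, inf t w == [set: 'I_n]%SET).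
  have ex : exists t, inf t w == [set: 'I_n]%SET by exists t.
  case: (ex_minnP ex) => m /eqP mfull mmin.
  have Tm : (spreading_time R v0 (fun t v => call t v w) <= (m%:R)%:E)%E.
    by apply: ereal_inf_lbound; exists m.
  apply: (le_trans Tm); apply: (le_trans _ (nneseries_lim_ge m (fun t _ _ => t_ge0 t))).
  rewrite sumEFin lee_fin -natr_sum ler_nat.
  rewrite -[leqLHS]subn0 -[leqLHS]muln1 -sum_nat_const_nat big_nat [leqRHS]big_nat.
  apply: leq_sum => s /andP[_ sm]; rewrite lt0b.
  by apply: contraTN sm => /mmin; rewrite -leqNgt.
rewrite [leRHS](_ : _ = +oo%E) ?leey//; apply/eqyP => A A0.
have [N AN] : exists N : nat, A <= N%:R.
  by exists (Num.truncn A).+1; apply/ltW/truncnS_gt.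
have AN' : (A%:E <= (N%:R)%:E)%E by rewrite lee_fin.
apply: (le_trans AN'); apply: (le_trans _ (nneseries_lim_ge N (fun t _ _ => t_ge0 t))).
rewrite sumEFin lee_fin -natr_sum ler_nat.
rewrite -[leqLHS]subn0 -[leqLHS]muln1 -sum_nat_const_nat.
by apply: leq_sum => s _; rewrite lt0b; apply/negP => sf; apply: nofull; exists s.
Qed.

Lemma expected_spreading_time :
  (\int[P]_w spreading_time R v0 (fun t v => call t v w) =
   \sum_(0 <= t <oo)
     (mean_after t (fun S => (S != [set: 'I_n]%SET)%:R) [set v0]%SET)%:E)%E.
Proof.
pose B : {set {set 'I_n}} := [set S | S != [set: 'I_n]%SET]%SET.
have mB t : measurable [set w | inf t w \in B] by exact: discrete_informed.
have indB t w : (w \in [set w | inf t w \in B]) = (inf t w != [set: 'I_n]%SET).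
  by apply/idP/idP; rewrite in_setE/= inE.
under eq_integral => w _ do rewrite spreading_timeE.
rewrite integral_nneseries//; last first.
- move=> t; apply/measurable_EFinP.
  rewrite (_ : (fun w => _) = \1_[set w | inf t w \in B]).
    exact: measurable_indic.
  by apply/funext => w; rewrite indicE indB.
apply: eq_eseriesr => t _.
transitivity (P [set w | inf t w \in B]); last first.
  by rewrite prob_informed; congr _%:E; apply: eq_mean_after => S; rewrite inE.
rewrite -[X in P X]setIT -integral_indic//; apply: eq_integral => w _.
by rewrite indicE indB.
Qed.

End pull_process.

(** * Logarithm inequalities *)

Section log_inequalities.
Import numFieldNormedType.Exports.
Context {R : realType}.
Implicit Types x y a : R.

(** Applying [ln (1 + y) <= y] to [1 / (1 + x)] gives the lower bound [x / (1 + x)], which exceeds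
    the quadratic by [x ^+ 2 * (1 + 2 * x) / (1 + x)]. *)
Lemma ln1D_quad_ge x : - 2^-1 <= x -> x - 2 * x ^+ 2 <= ln (1 + x).
Proof.
move=> hx; have x1 : 0 < 1 + x by lra.
have : ln (1 + (- x / (1 + x))) <= - x / (1 + x).
  by apply: le_ln1Dx; rewrite ltr_pdivlMr//; lra.
have -> : 1 + (- x / (1 + x)) = (1 + x)^-1 by field; lra.
rewrite lnV ?posrE// lerNl; apply: le_trans.
rewrite mulNr opprK ler_pdivlMr//.
have : 0 <= x ^+ 2 * (1 + 2 * x) by rewrite mulr_ge0 ?sqr_ge0//; lra.
by lra.
Qed.

(** With [y = expR (- x)] this is the tangent bound at [expR (- a)] for [- ln (- ln y)], which is
    concave for [0 < y <= expR (- 1)]. The proof shows that [a] minimises [G] on the reals from 1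
    on. *)
Lemma ln_tangent_exp (a x : R) : 1 <= a -> 1 <= x ->
  ln a - ln x <= (expR (a - x) - 1) / a.
Proof.
move=> a1 x1.
pose G y := expR (a - y) + a * ln y.
have dG y : 0 < y -> is_derive y 1 G (- expR (a - y) + a / y).
  move=> y0; rewrite /G.
  have := is_derive1_ln y0 => dln.
  apply: is_derive_eq.
  by rewrite /GRing.scale/=; lra.
suff : G a <= G x.
  rewrite /G subrr expR0 ler_pdivlMr; last by lra.
  by lra.
have cG b c : 0 < b -> {within `[b, c], continuous G}.
  move=> b0; apply: derivable_within_continuous => y; rewrite in_itv/= => /andP[by_ _].
  by have [] := dG y (lt_le_trans b0 by_).
have dG' b c y : 1 <= b -> y \in `]b, c[ -> is_derive y 1 G (- expR (a - y) + a / y).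
  by move=> b1; rewrite in_itv/= => /andP[by_ _]; apply: dG; lra.
have cG' b c : 1 <= b -> {within `[b, c], continuous G}.
  by move=> b1; apply: cG; lra.
have [ax|/ltW xa] := leP a x.
  have [c] := MVT_segment ax (fun y => dG' a x y a1) (cG' a x a1).
  rewrite in_itv/= => /andP[ac cx] E; rewrite -subr_ge0 E mulr_ge0 ?subr_ge0//.
  have c0 : 0 < c by lra.
  rewrite addrC subr_ge0 ler_pdivlMr//.
  have := expRxMexpNx_1 (a - c); rewrite opprB => e1.
  have := expR_ge1Dx (c - a); have := expR_gt0 (a - c).
  have : 0 <= (c - a) * (a - 1) by rewrite mulr_ge0; lra.
  by nra.
have [c] := MVT_segment xa (fun y => dG' x a y x1) (cG' x a x1).
rewrite in_itv/= => /andP[xc ca] E.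
rewrite -subr_le0 E mulr_le0_ge0 ?subr_ge0//.
have c0 : 0 < c by lra.
rewrite addrC subr_le0 ler_pdivrMr//.
have := expR_ge1Dx (a - c).
have : 0 <= (a - c) * (c - 1) by rewrite mulr_ge0; lra.
by nra.
Qed.

Lemma expR1_le4 : expR 1 <= 4 :> R.
Proof.
have := expRxMexpNx_1 (- 2^-1 : R); rewrite opprK => e1.
have g0 := expR_gt0 (2^-1 : R).
have g2 : expR 2^-1 <= 2 :> R by have := expR_ge1Dx (- 2^-1 : R); nra.
by rewrite [leLHS](_ : _ = expR 2^-1 * expR 2^-1); [nra|rewrite -expRD; congr expR; lra].
Qed.

Lemma ln2_gt0 : 0 < ln 2 :> R.
Proof. by apply: ln_gt0; lra. Qed.

Lemma ln2_le1 : ln 2 <= 1 :> R.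
Proof. by have := @le_ln1Dx R 1; rewrite -natr1; apply; lra. Qed.

Lemma Nln_ge1 x : 0 < x -> x <= 4^-1 -> 1 <= - ln x.
Proof.
move=> x0 x4; rewrite -lnV ?posrE// -[leLHS]expRK ler_ln ?posrE ?expR_gt0 ?invr_gt0//.
by apply: (le_trans expR1_le4); rewrite -[leLHS]invrK lef_pV2 ?posrE.
Qed.

End log_inequalities.

(** * Upper bound *)

Section upper_bound.
Context {R : realType} {n : nat}.
Hypothesis n_ge8 : (8 <= n)%N.
Implicit Types (f Phi : {set 'I_n} -> R) (S : {set 'I_n}) (u i j : nat).

Let n_gt0 : (0 < n)%N. Proof. exact: leq_trans n_ge8. Qed.

Let nR_gt0 : 0 < n%:R :> R. Proof. by rewrite ltr0n. Qed.

(** The drift in the first round pays for [f S], and induction from the next set pays for the rest.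
    Supersets of [S0] suffice because informed sets grow. *)
Lemma sum_mean_after_le Phi f S0 N :
  (forall S, S0 \subset S -> 0 <= Phi S) ->
  (forall S, S0 \subset S -> pull_mean Phi S + f S <= Phi S) ->
  \sum_(t < N) mean_after t f S0 <= Phi S0.
Proof.
move=> Phi0 drift.
suff H S : S0 \subset S -> \sum_(t < N) mean_after t f S <= Phi S by exact: H.
elim: N S => [|N IH] S S0S; first by rewrite big_ord0 Phi0.
rewrite big_ord_recl/= addrC; apply: le_trans (drift _ S0S); rewrite lerD2r.
rewrite -(pull_mean_sum _ (fun t : 'I_N => mean_after t f)).
by apply: le_pull_mean => S' SS'; apply/IH/(fintype.subset_trans S0S).
Qed.

(* The informed fraction doubles as long as it is small, so [- ln i] alone drops
   by [ln 2] in the mean, up to the effect of the variance of the number of newly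
   informed nodes, which [2 / i] absorbs, and to the calls made by informed nodes,
   which the last term absorbs. *)
Definition early_potential i : R :=
  ln n%:R - ln i%:R + 2 / i%:R + 16 * (1 - i%:R / n%:R).

Lemma le_early_potential i j : (0 < i)%N -> (i <= j)%N ->
  early_potential j <= early_potential i.
Proof.
move=> i0 ij; have j0 := leq_trans i0 ij.
have ijR : i%:R <= j%:R :> R by rewrite ler_nat.
rewrite /early_potential lerD//; last first.
  by rewrite ler_pM2l// lerD2l lerN2 ler_pM2r// invr_gt0.
rewrite lerD//; last by rewrite ler_pM2l// lef_pV2 ?posrE ?ltr0n.
by rewrite lerD2l lerN2 ler_ln ?posrE ?ltr0n.
Qed.

Lemma early_potential_ge0 i : (0 < i)%N -> (i <= n)%N -> 0 <= early_potential i.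
Proof.
move=> i0 i_n; apply: (le_trans _ (le_early_potential i n i0 i_n)).
by rewrite /early_potential subrr divff ?gt_eqF// subrr mulr0 add0r addr0 divr_ge0.
Qed.

(** The number of newly informed nodes is binomial with mean [i * rho] and variance [i * rho ^+ 2];
    dividing by [i] gives the two moments used here. *)
Lemma pull_mean_gain (a b e : R) S : (0 < #|S|)%N ->
  let i := #|S|%:R : R in let rho := #|~: S|%:R / n%:R : R in
  pull_mean (fun S' => a + b * ((#|S'|%:R - i) / i)
                       + e * ((#|S'|%:R - i) / i) ^+ 2) S =
  a + b * rho + e * (rho ^+ 2 * (1 + i^-1)).
Proof.
move=> S0 i rho.
have i0 : i != 0 by rewrite pnatr_eq0 -lt0n.
have n0 : n%:R != 0 :> R by rewrite gt_eqF.
have cardE (T : {set 'I_n}) : #|T|%:R = n%:R - #|~: T|%:R :> R by rewrite (uninfE T); ring.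
set u : R := #|~: S|%:R.
have iE : i = n%:R - u by exact: cardE.
rewrite (eq_pull_mean _ (fun S' => (a + b * (u / i) + e * (u / i) ^+ 2)
   + (- b / i - 2 * e * u / i ^+ 2) * #|~: S'|%:R
   + (e / i ^+ 2) * #|~: S'|%:R ^+ 2)); last first.
  by move=> S'; rewrite (cardE S'); move: i0; rewrite iE => i0; field.
rewrite pull_mean_quad// -/u /rho -/u.
by move: i0; rewrite iE => i0; field; rewrite i0 n0.
Qed.

(** The potential is bounded by a quadratic polynomial in the relative gain [r]. Its mean is
    explicit, which leaves a polynomial inequality in [rho] and [i^-1]. *)
Lemma early_drift S : (0 < #|S|)%N -> (n %/ 16 < #|~: S|)%N ->
  pull_mean (fun S' => early_potential #|S'|) S <= early_potential #|S| - ln 2.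
Proof.
move=> S0 Su; set i : R := #|S|%:R; set rho : R := #|~: S|%:R / n%:R.
have i1 : 1 <= i by rewrite ler1n.
have i0 : 0 < i by lra.
pose r S' : R := (#|S'|%:R - i) / i.
pose c : R := 1 - i / n%:R.
apply: (@le_trans _ _ (pull_mean (fun S' =>
    (ln n%:R - ln i - ln 2 + 1 + 2 / i + 16 * c)
    + (- (3 / 2) - 3 / 2 / i - 16 * (i / n%:R)) * r S'
    + (2^-1 + 2^-1 / i) * r S' ^+ 2) S)).
  apply: le_pull_mean => S' SS'; rewrite /early_potential.
  have iS' : i <= #|S'|%:R by rewrite ler_nat subset_leq_card.
  set x : R := #|S'|%:R in iS' *.
  have rS' : r S' = (x - i) / i by [].
  have r0 : 0 <= r S' by rewrite rS' divr_ge0 ?subr_ge0// ltW.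
  have xE : x = i * (1 + r S') by rewrite rS'; field; lra.
  (* Expansion of [ln x] around the doubled size [2 * i]; [r S' >= 0] keeps the relative deviation
     [(r S' - 1) / 2] above [- 2^-1]. *)
  have lnx : ln i + ln 2 + ((r S' - 1) / 2 - 2 * ((r S' - 1) / 2) ^+ 2) <= ln x.
    have -> : x = i * 2 * (1 + (r S' - 1) / 2) by rewrite {1}xE; field.
    have r1 : 0 < 1 + (r S' - 1) / 2 by lra.
    rewrite !lnM ?posrE ?mulr_gt0//.
    by rewrite lerD2l; apply: ln1D_quad_ge; lra.
  (* The quadratic meets [1 / (1 + r)] at [r = 0] and touches it at [r = 1], the case of
     doubling. *)
  have invx : x^-1 <= i^-1 * (1 - 3 / 4 * r S' + r S' ^+ 2 / 4).
    rewrite xE invfM ler_pM2l ?invr_gt0// -[leLHS]mul1r ler_pdivrMr; last by lra.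
    have : 0 <= r S' * (1 - r S') ^+ 2 by rewrite mulr_ge0 ?sqr_ge0.
    by lra.
  have -> : x / n%:R = i / n%:R + i / n%:R * r S' by rewrite {1}xE; ring.
  rewrite /c; move: lnx invx; rewrite expr2; lra.
rewrite pull_mean_gain// -/i -/rho.
have rhoE : rho = c.
  by rewrite /rho /c /i (uninfE S); field; rewrite gt_eqF.
have rho1 : 16^-1 <= rho.
  rewrite /rho ler_pdivlMr// mulrC ler_pdivrMr//.
  by rewrite -natrM ler_nat; lia.
rewrite /early_potential -/i -/c -rhoE.
have -> : i / n%:R = 1 - rho by rewrite rhoE /c; ring.
set k := i^-1.
have k0 : 0 < k by rewrite invr_gt0.
have k1 : k <= 1 by rewrite invf_le1.
have rho_le1 : rho <= 1 by rewrite rhoE /c gerBl divr_ge0// ltW.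
have rho0 : 0 <= rho by lra.
have rho10 : 0 <= 1 - rho by lra.
have k10 : 0 <= 1 - k by lra.
(* [h1] and [h2] control the terms containing [k]. The others amount to
   [(1 - rho) * (1 - 33 / 2 * rho) <= 0], which follows from [h3]: the coefficient 16 of the
   potential suits the threshold [16^-1]. *)
have h1 : 0 <= k * rho * (1 - rho) by rewrite !mulr_ge0// ltW.
have h2 : 0 <= (1 - k) * (k * rho ^+ 2) by rewrite !mulr_ge0 ?sqr_ge0// ltW.
have h3 : 0 <= (1 - rho) * (rho - 16^-1) by rewrite mulr_ge0; lra.
nra.
Qed.

(* The uninformed fraction [x = u / n] is squared in the mean and [- ln (- ln x)]
   drops by [ln 2] under squaring. Using [(2 * u + 1) / n] instead of [x] keeps
   the value at [u = 0] finite and the drift intact for [n <= 2 * u ^+ 2]; below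
   that, Markov's inequality makes the last term drop by enough. *)
Definition late_potential u : R :=
  ln (ln n%:R) - ln (- ln ((2 * u%:R + 1) / n%:R)) + 2 * ln 2 * (0 < u)%:R.

Lemma late_arg_gt0 u : 0 < (2 * u%:R + 1) / n%:R :> R.
Proof. by rewrite divr_gt0// ltr_wpDl// mulr_ge0. Qed.

(** The threshold [n %/ 16] keeps the argument in the range of concavity:
    [4 * (2 * u + 1) <= n / 2 + 4 <= n] as [n >= 8]. *)
Lemma late_arg_ge1 u : (u <= n %/ 16)%N -> 1 <= - ln ((2 * u%:R + 1) / n%:R : R).
Proof.
move=> un; apply: Nln_ge1; first exact: late_arg_gt0.
rewrite ler_pdivrMr// [leRHS]mulrC ler_pdivlMr//.
by rewrite -natrM natr1 -natrM ler_nat; lia.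
Qed.

Lemma le_late_potential u j : (u <= j)%N -> (j <= n %/ 16)%N ->
  late_potential u <= late_potential j.
Proof.
move=> uj jn; rewrite /late_potential lerD//; last first.
  rewrite ler_pM2l ?mulr_gt0 ?ln2_gt0// ler_nat.
  by case: u uj => // u uj; rewrite (leq_ltn_trans _ uj).
rewrite lerD2l lerN2 ler_ln ?posrE; last 2 first.
- by rewrite (lt_le_trans ltr01)// late_arg_ge1.
- by rewrite (lt_le_trans ltr01)// late_arg_ge1// (leq_trans uj).
rewrite lerN2 ler_ln ?posrE ?late_arg_gt0//.
by rewrite ler_pM2r ?invr_gt0// lerD2r ler_pM2l// ler_nat.
Qed.

Lemma late_potential0 : late_potential 0 = 0.
Proof. by rewrite /late_potential !mulr0 add0r mul1r lnV ?posrE// opprK subrr addr0. Qed.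

Lemma late_potential_ge0 u : (u <= n %/ 16)%N -> 0 <= late_potential u.
Proof. by move=> un; rewrite -late_potential0; exact: le_late_potential. Qed.

(** Jensen's inequality, via the tangent at the mean [y0], bounds the mean of the double logarithm
    without any variance estimate. *)
Lemma late_drift S : (0 < #|~: S|)%N -> (#|~: S| <= n %/ 16)%N ->
  pull_mean (fun S' => late_potential #|~: S'|) S
  <= late_potential #|~: S| - ln 2.
Proof.
move=> S0 Su; set u : R := #|~: S|%:R.
pose y0 : R := (2 * (u * (u / n%:R)) + 1) / n%:R.
have u1 : 1 <= u by rewrite ler1n.
have ln2 := @ln2_gt0 R.
have y0_gt0 : 0 < y0.
  by rewrite divr_gt0// ltr_wpDl// !mulr_ge0 ?invr_ge0// ltW.
have u_n : u <= n%:R by rewrite ler_nat -[leqRHS]card_ord max_card.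
have un1 : u / n%:R <= 1 by rewrite ler_pdivrMr// mul1r.
have y0_le : y0 <= (2 * u + 1) / n%:R.
  by rewrite /y0 ler_pM2r ?invr_gt0// lerD2r ler_pM2l// ger_pMr//; lra.
set a := - ln ((2 * u + 1) / n%:R).
have a1 : 1 <= a by exact: late_arg_ge1.
have aa0 : a <= - ln y0 by rewrite lerN2 ler_ln ?posrE ?late_arg_gt0.
set a0 := - ln y0 in aa0 *.
have a0_gt0 : 0 < a0 by lra.
(* The tangent at [y0], the mean of [y']. *)
have tangent S' : S \subset S' ->
  - ln (- ln ((2 * #|~: S'|%:R + 1) / n%:R)) <=
  - ln a0 + ((2 * #|~: S'|%:R + 1) / n%:R / y0 - 1) / a0.
  move=> SS'; set y' := _ / n%:R; rewrite -lerBlDl opprK addrC.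
  have -> : y' / y0 = expR (a0 - - ln y').
    rewrite opprK /a0 addrC -ln_div ?posrE ?late_arg_gt0//.
    by rewrite lnK// posrE divr_gt0// late_arg_gt0.
  apply: ln_tangent_exp; first by lra.
  apply: late_arg_ge1; apply: leq_trans Su.
  by rewrite subset_leq_card// finset.setCS.
(* The linear part of the tangent vanishes on average, since [y0] is the mean of its argument. *)
have mean (c b : R) : pull_mean (fun S' => c +
    (- ln a0 + ((2 * #|~: S'|%:R + 1) / n%:R / y0 - 1) / a0)
    + b * #|~: S'|%:R) S = c - ln a0 + b * (u * (u / n%:R)).
  rewrite (eq_pull_mean _ (fun S' =>
    (c - ln a0 + (n%:R^-1 / y0 - 1) / a0) +
    (2 / n%:R / y0 / a0 + b) * #|~: S'|%:R + 0 * #|~: S'|%:R ^+ 2)); last first.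
    by move=> S'; field; rewrite !gt_eqF.
  rewrite pull_mean_quad// -/u mul0r addr0.
  transitivity (c - ln a0 + b * (u * (u / n%:R)) + (y0 / y0 - 1) / a0).
    by rewrite {3}/y0; ring.
  by rewrite divff ?gt_eqF// subrr mul0r addr0.
rewrite {2}/late_potential -/u -/a S0 mulr1.
(* For [n <= 2 * u ^+ 2], [y0] is at most the square of the current argument, so the double
   logarithm drops by [ln 2]. Otherwise it merely does not increase, while the mean number of
   uninformed nodes is below 1/2, so the last term falls from [2 * ln 2] to at most [ln 2]. *)
have [nu|un] := leP n%:R (2 * u ^+ 2).
  apply: (@le_trans _ _ (ln (ln n%:R) + 2 * ln 2 - ln a0 + 0 * (u * (u / n%:R)))).
    rewrite -mean; apply: le_pull_mean => S' SS'.
    have le2 : 2 * ln 2 * (0 < #|~: S'|)%:R <= 2 * ln 2 :> R.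
      by rewrite ger_pMr ?mulr_gt0// lern1 leq_b1.
    by have := tangent S' SS'; rewrite mul0r addr0 /late_potential; lra.
  have : ln 2 + ln a <= ln a0.
    rewrite -lnM ?posrE//; last by lra.
    rewrite ler_ln ?posrE; [|by lra|by lra].
    rewrite (_ : 2 * a = - ln (((2 * u + 1) / n%:R) ^+ 2)); last first.
      by rewrite lnXn ?late_arg_gt0// mulr2n /a; ring.
    rewrite lerN2 ler_ln ?posrE ?exprn_gt0 ?late_arg_gt0//.
    rewrite (_ : y0 = (2 * u ^+ 2 + n%:R) / n%:R ^+ 2); last first.
      by rewrite /y0; field; rewrite gt_eqF.
    rewrite expr_div_n ler_pM2r ?invr_gt0 ?exprn_gt0//.
    by move: nu; rewrite expr2; lra.
  by rewrite mul0r addr0; lra.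
apply: (@le_trans _ _ (ln (ln n%:R) - ln a0 + 2 * ln 2 * (u * (u / n%:R)))).
  rewrite -mean; apply: le_pull_mean => S' SS'.
  rewrite /late_potential lerD//; first by rewrite lerD2l; exact: tangent.
  rewrite ler_pM2l ?mulr_gt0// ler_nat; by case: #|_|.
have : ln a <= ln a0 by rewrite ler_ln ?posrE//; lra.
have : 2 * ln 2 * (u * (u / n%:R)) <= ln 2.
  rewrite mulrAC ger_pMl// !mulrA ler_pdivrMr//.
  by move: un; rewrite expr2; lra.
by lra.
Qed.

(** In each phase one part drops by [ln 2] in the mean and the other does not increase; dividing by
    [ln 2] makes the drift 1. The minimum freezes the late part. *)
Definition potential S : R :=
  (early_potential #|S| + late_potential (minn #|~: S| (n %/ 16))) / ln 2.

Lemma le_potential S S' : (0 < #|S|)%N -> S \subset S' ->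
  potential S' <= potential S.
Proof.
move=> S0 SS'; rewrite ler_pM2r ?invr_gt0 ?ln2_gt0// lerD//.
  by rewrite le_early_potential// subset_leq_card.
rewrite le_late_potential// ?geq_minr// leq_min geq_minr andbT.
by rewrite (leq_trans (geq_minl _ _))// subset_leq_card// finset.setCS.
Qed.

Lemma potential_drift S : (0 < #|S|)%N ->
  pull_mean potential S + (S != [set: 'I_n]%SET)%:R <= potential S.
Proof.
move=> S0; have [->|ST] := eqVneq S [set: 'I_n]%SET.
  rewrite addr0 -[leRHS](pull_mean_cst n_gt0 _ [set: 'I_n]%SET).
  apply: le_pull_mean => S'; apply: le_potential.
  by rewrite cardsT card_ord.
have CS0 : (0 < #|~: S|)%N.
  rewrite card_gt0; apply: contra_neq ST => CS; by rewrite -[S]finset.setCK CS finset.setC0.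
have ln2 := @ln2_gt0 R; have ln2i : 0 < (ln 2)^-1 :> R by rewrite invr_gt0.
rewrite -lerBrDr [leRHS](_ : _ = (early_potential #|S|
    + late_potential (minn #|~: S| (n %/ 16)) - ln 2) / ln 2); last first.
  by rewrite mulrBl divff ?gt_eqF.
have [Su|Su] := leqP #|~: S| (n %/ 16).
  rewrite -addrA.
  apply: (@le_trans _ _ (pull_mean (fun S' => early_potential #|S| / ln 2
      + (ln 2)^-1 * late_potential #|~: S'|) S)).
    apply: le_pull_mean => S' SS'.
    rewrite /potential mulrC [_ / ln 2]mulrC -mulrDr ler_pM2l//.
    have SCS : (#|~: S'| <= #|~: S|)%N.
      by rewrite subset_leq_card// finset.setCS.
    rewrite (minn_idPl (leq_trans SCS Su)) lerD2r.
    by rewrite le_early_potential// subset_leq_card.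
  rewrite pull_meanD pull_mean_cst// pull_meanZ mulrC -mulrDr [leRHS]mulrC.
  by rewrite ler_pM2l// lerD2l late_drift.
rewrite addrAC.
apply: (@le_trans _ _ (pull_mean (fun S' => late_potential (n %/ 16) / ln 2
    + (ln 2)^-1 * early_potential #|S'|) S)).
  apply: le_pull_mean => S' SS'.
  rewrite /potential mulrC [_ / ln 2]mulrC -mulrDr ler_pM2l// addrC lerD2r.
  by rewrite le_late_potential// geq_minr.
rewrite pull_meanD pull_mean_cst// pull_meanZ mulrC -mulrDr [leRHS]mulrC.
by rewrite ler_pM2l//; have := early_drift S S0 Su; lra.
Qed.

Lemma sum_prob_uninformed_le (v0 : 'I_n) N :
  \sum_(t < N) mean_after t (fun S => (S != [set: 'I_n]%SET)%:R) [set v0]%SET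
  <= (ln n%:R + ln (ln n%:R) + 18) / ln 2 + 2 :> R.
Proof.
have card_gt0 S : [set v0]%SET \subset S -> (0 < #|S|)%N.
  by move=> /subset_leq_card; rewrite cards1.
have ln2 := @ln2_gt0 R.
apply: le_trans (sum_mean_after_le potential _ _ _ _ _) _.
- move=> S /card_gt0 S0; rewrite divr_ge0 ?(ltW ln2)// addr_ge0//.
    by rewrite early_potential_ge0// -[leqRHS]card_ord max_card.
  by rewrite late_potential_ge0// geq_minr.
- by move=> S /card_gt0; exact: potential_drift.
rewrite /potential cards1 ler_pdivrMr// mulrDl divfK ?gt_eqF//.
(* With one informed node the early part is [ln n + 2 + 16 * (1 - 1 / n)], hence the 18. *)
apply: (@le_trans _ _ ((ln n%:R + 18) + (ln (ln n%:R) + 2 * ln 2))); last by lra.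
apply: lerD.
  rewrite /early_potential ln1 subr0 divr1.
  have : 0 <= 1 / n%:R :> R by rewrite divr_ge0.
  by lra.
apply: (le_trans (le_late_potential _ _ (geq_minr _ _) (leqnn _))).
rewrite /late_potential lerD//.
  by rewrite gerBl ln_ge0// late_arg_ge1.
by rewrite ger_pMr ?mulr_gt0// lern1 leq_b1.
Qed.

End upper_bound.

(** * Lower bound *)

Section lower_bound.
Context {R : realType} {n : nat}.
Hypothesis n_gt0 : (0 < n)%N.
Implicit Types (S : {set 'I_n}) (k s t : nat).

Let nR_gt0 : 0 < n%:R :> R. Proof. by rewrite ltr0n. Qed.

Local Notation full := (fun S : {set 'I_n} => (S == [set: 'I_n]%SET)%:R : R).

Lemma mean_after_full_le1 k S : mean_after k full S <= 1.
Proof.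
rewrite -[leRHS](mean_after_cst n_gt0 k 1 S).
by apply: le_mean_after => S' _; rewrite lern1 leq_b1.
Qed.

(** The binomial variance is [m - u * (u / n) ^+ 2]. *)
Lemma pull_mean_variance_le S (m : R) : m = #|~: S|%:R * (#|~: S|%:R / n%:R) ->
  pull_mean (fun S' => (#|~: S'|%:R - m) ^+ 2) S <= m.
Proof.
set u : R := #|~: S|%:R => mE.
rewrite (eq_pull_mean _ (fun S' =>
    m ^+ 2 + (- 2 * m) * #|~: S'|%:R + 1 * #|~: S'|%:R ^+ 2)); last first.
  by move=> S'; ring.
rewrite pull_mean_quad// -/u -mE.
have : 0 <= u * (u / n%:R) ^+ 2 by rewrite mulr_ge0 ?sqr_ge0.
have -> : m ^+ 2 = u ^+ 2 * (u / n%:R) ^+ 2 by rewrite mE exprMn.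
have -> : - 2 * m * m = - 2 * (u ^+ 2 * (u / n%:R) ^+ 2) by rewrite mE; ring.
by rewrite expr2; lra.
Qed.

(** Unless the next [u] is below half its mean [m], the ratio [2 * n / u] is at most squared in a
    round. Each of the [k] rounds adds one Chebyshev failure term to the bound. *)
Lemma mean_after_full_le k S : (0 < #|~: S|)%N ->
  mean_after k full S <= k%:R * (2 * n%:R / #|~: S|%:R) ^+ (2 ^ k) / n%:R.
Proof.
elim: k S => [|k IH] S Su.
  rewrite !mul0r /= (_ : _ == _ = false)//; apply/eqP => ST.
  by move: Su; rewrite ST finset.setCT cards0.
set u : R := #|~: S|%:R.
have u_gt0 : 0 < u by rewrite ltr0n.
have u_n : u <= n%:R by rewrite ler_nat -[leqRHS]card_ord max_card.
pose m : R := u * (u / n%:R).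
have m_gt0 : 0 < m by rewrite mulr_gt0// divr_gt0.
pose z : R := 2 * n%:R / u.
have z_ge1 : 1 <= z by rewrite /z ler_pdivlMr// mul1r; lra.
(* Chebyshev's inequality, outcome by outcome: either [u' >= m / 2] and the induction hypothesis
   applies, or the quadratic term is at least 1. *)
apply: (@le_trans _ _ (pull_mean (fun S' => k%:R * z ^+ (2 ^ k.+1) / n%:R
    + 4 / m ^+ 2 * (#|~: S'|%:R - m) ^+ 2) S)).
  apply: le_pull_mean => S' SS'; set u' : R := #|~: S'|%:R.
  have [mu'|u'm] := leP m (2 * u').
    have u'_gt0 : 0 < u' by lra.
    have Su' : (0 < #|~: S'|)%N by move: u'_gt0; rewrite ltr0n.
    apply: (le_trans (IH _ Su')); rewrite -[leLHS]addr0 lerD//; last first.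
      by rewrite mulr_ge0 ?sqr_ge0// divr_ge0// sqr_ge0.
    rewrite ler_pM2r ?invr_gt0// ler_wpM2l// expnS exprM.
    rewrite lerXn2r ?nnegrE ?sqr_ge0 ?divr_ge0 ?mulr_ge0//.
    rewrite -/u' ler_pdivrMr//.
    have -> : z ^+ 2 * u' = 4 * n%:R / u ^+ 2 * (n%:R * u').
      by rewrite /z; field; rewrite gt_eqF.
    apply: (@le_trans _ _ (4 * n%:R / u ^+ 2 * (u ^+ 2 / 2))).
      rewrite le_eqVlt; apply/orP; left; apply/eqP; field.
      by rewrite gt_eqF.
    rewrite ler_pM2l; last by rewrite divr_gt0 ?exprn_gt0// mulr_gt0.
    have : n%:R * m <= n%:R * (2 * u') by rewrite ler_pM2l.
    have -> : n%:R * m = u ^+ 2 by rewrite /m; field; rewrite gt_eqF.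
    by lra.
  apply: (le_trans (mean_after_full_le1 k S')).
  rewrite -[leLHS]add0r lerD//.
    by rewrite divr_ge0// mulr_ge0// exprn_ge0//; lra.
  rewrite mulrAC ler_pdivlMr ?exprn_gt0// mul1r.
  have : 0 <= (m - 2 * u') * (3 * m - 2 * u') by rewrite mulr_ge0; lra.
  by rewrite !expr2; lra.
rewrite pull_meanD pull_mean_cst// pull_meanZ -/z.
apply: (@le_trans _ _ (k%:R * z ^+ (2 ^ k.+1) / n%:R + 4 / m ^+ 2 * m)).
  by rewrite lerD2l ler_pM2l ?divr_gt0 ?exprn_gt0// pull_mean_variance_le.
(* The failure term [4 / m] is at most one more summand [z ^+ (2 ^ k.+1) / n], because [z >= 1]. *)
have -> : 4 / m ^+ 2 * m = z ^+ 2 / n%:R.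
  by rewrite /z /m; field; rewrite !gt_eqF.
rewrite -mulrDl ler_pM2r ?invr_gt0// -natr1 mulrDl mul1r lerD2l.
by rewrite ler_weXn2l// expnS leq_pmulr// expn_gt0.
Qed.

(** If at least half of the nodes are uninformed, the ratio [2 * n / u] is at most 4; otherwise the
    first term exceeds 1. Being affine in [#|S|], the bound can be averaged using the mean alone. *)
Lemma mean_after_full_card_le k S : mean_after k full S <=
  2 / n%:R * #|S|%:R + k%:R * 4 ^+ (2 ^ k) / n%:R.
Proof.
have [nu|un] := leqP n (2 * #|~: S|).
  have Su : (0 < #|~: S|)%N by lia.
  apply: (le_trans (mean_after_full_le k S Su)).
  rewrite -[leLHS]add0r lerD//.
  rewrite ler_pM2r ?invr_gt0// ler_wpM2l// lerXn2r ?nnegrE//.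
  by rewrite ler_pdivrMr ?ltr0n// -!natrM ler_nat; lia.
apply: (le_trans (mean_after_full_le1 k S)).
rewrite -[leLHS]addr0 lerD//.
rewrite mulrAC ler_pdivlMr// mul1r -natrM ler_nat.
by have := cardsC S; rewrite card_ord; lia.
Qed.

(** From [i] informed nodes, one round leads to the mean [2 * i - i ^+ 2 / n]. *)
Lemma mean_after_card_le t S :
  mean_after t (fun S' => #|S'|%:R) S <= 2 ^+ t * #|S|%:R :> R.
Proof.
have step S' : pull_mean (fun S'' => #|S''|%:R) S' <= 2 * #|S'|%:R :> R.
  have cardE (T : {set 'I_n}) : #|T|%:R = n%:R - #|~: T|%:R :> R.
    by rewrite (uninfE T); ring.
  rewrite (eq_pull_mean _ (fun T => n%:R + (-1) * #|~: T|%:R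
    + 0 * #|~: T|%:R ^+ 2)); last by move=> T; rewrite cardE; ring.
  rewrite pull_mean_quad// mul0r addr0 (cardE S'); set u : R := #|~: S'|%:R.
  rewrite -subr_ge0 [leRHS](_ : _ = (n%:R - u) ^+ 2 / n%:R).
    by rewrite divr_ge0// sqr_ge0.
  by field; rewrite gt_eqF.
elim: t S => [|t IH] S; first by rewrite expr0 mul1r.
rewrite mean_afterS exprSr -mulrA.
apply: (@le_trans _ _ (mean_after t (fun S' => 2 * #|S'|%:R) S)).
  by apply: le_mean_after => S' _; exact: step.
by rewrite mean_afterZ mulrCA ler_pM2l.
Qed.

Lemma prob_full_le (v0 : 'I_n) s k :
  mean_after (s + k) full [set v0]%SET <=
  2 ^+ s.+1 / n%:R + k%:R * 4 ^+ (2 ^ k) / n%:R.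
Proof.
rewrite /mean_after iterD -!/(mean_after _ _).
apply: (@le_trans _ _ (mean_after s (fun S => 2 / n%:R * #|S|%:R
  + k%:R * 4 ^+ (2 ^ k) / n%:R) [set v0]%SET)).
  by apply: le_mean_after => S _; exact: mean_after_full_card_le.
rewrite mean_afterD mean_afterZ mean_after_cst// lerD2r.
rewrite exprS [leRHS]mulrAC ler_pM2l ?divr_gt0//.
by have := mean_after_card_le s [set v0]%SET; rewrite cards1 mulr1.
Qed.

(** Times [t < K] use no doubling round and [t] squaring rounds; times [K + s] use [s] doubling and
    [K] squaring rounds. The doubling errors form a geometric sum. *)
Lemma sum_prob_uninformed_ge (v0 : 'I_n) K L :
  (K + L)%:R - (2 * K%:R + 2 * 2 ^+ L + (K + L)%:R * K%:R * 4 ^+ (2 ^ K)) / n%:R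
  <= \sum_(t < K + L) mean_after t (fun S => (S != [set: 'I_n]%SET)%:R) [set v0]%SET :> R.
Proof.
pose q : R := K%:R * 4 ^+ (2 ^ K) / n%:R.
have E t : mean_after t (fun S => (S != [set: 'I_n]%SET)%:R) [set v0]%SET =
    1 - mean_after t full [set v0]%SET.
  rewrite (eq_mean_after _ _ (fun S => 1 + (-1) * full S)) => [|S].
    by rewrite mean_afterD mean_afterZ mean_after_cst// mulN1r.
  by case: (S == [set: 'I_n]%SET) => /=; lra.
under eq_bigr do rewrite E.
rewrite big_split/= sumr_const card_ord sumrN lerD2l lerN2 big_split_ord/=.
have early (t : 'I_K) : mean_after t full [set v0]%SET <= 2 / n%:R + q.
  have := prob_full_le v0 0 t; rewrite add0n expr1 => /le_trans; apply.
  rewrite lerD2l ler_pM2r ?invr_gt0// ler_pM//.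
    by rewrite ler_nat ltnW.
  by rewrite ler_weXn2l ?ler1n// leq_exp2l// ltnW.
have late (s : 'I_L) :
    mean_after (K + s) full [set v0]%SET <= 2 ^+ s.+1 / n%:R + q.
  by rewrite addnC; exact: prob_full_le.
apply: (@le_trans _ _ (\sum_(t < K) (2 / n%:R + q)
    + \sum_(s < L) (2 ^+ s.+1 / n%:R + q))).
  by apply: lerD; apply: ler_sum.
rewrite !big_split/= !sumr_const !card_ord -mulr_suml.
have pow : \sum_(s < L) 2 ^+ s.+1 <= 2 * 2 ^+ L :> R.
  under eq_bigr do rewrite exprS.
  rewrite -mulr_sumr ler_pM2l//.
  by have := subrX1 (2 : R) L; rewrite (_ : 2 - 1 = 1) ?mul1r => [<-|]; lra.
have powd : (\sum_(s < L) 2 ^+ s.+1) / n%:R <= 2 * 2 ^+ L / n%:R :> R.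
  by rewrite ler_pM2r ?invr_gt0.
rewrite -[_ *+ K]mulr_natr -[q *+ K]mulr_natr -[q *+ L]mulr_natr natrD /q.
by move: powd; lra.
Qed.

End lower_bound.

(** * Asymptotics *)

(** With [w = 2 ^ K] and [a = 2 ^ w], [4 * w <= L < 8 * w] gives [a ^ 4 <= 2 ^ L] and
    [K + L <= 9 * w]. The three summands are then at most 2, 2 and 9 times [2 ^ L]. *)
Lemma lower_bound_loss_le (n L K : nat) :
  (2 ^ L <= n)%N -> (2 ^ (K + 2) <= L < 2 ^ (K + 3))%N ->
  (2 * K + 2 * 2 ^ L + (K + L) * K * 4 ^ (2 ^ K) <= 13 * n)%N.
Proof.
rewrite !expnD => Ln /andP[]; set w := (2 ^ K)%N => wL Lw.
have Kw : (K < w)%N by rewrite ltn_expl.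
set a := (2 ^ w)%N.
have wa : (w <= a)%N by rewrite ltnW// ltn_expl.
have -> : (4 ^ w = a * a)%N by rewrite -expnMn.
have aL : (a * a * (a * a) <= 2 ^ L)%N.
  by rewrite -!expnD leq_exp2l//; lia.
have KL : ((K + L) * K * (a * a) <= 9 * (a * a * (a * a)))%N.
  apply: (@leq_trans (9 * (w * w) * (a * a))).
    by rewrite leq_mul2r mulnA leq_mul ?orbT//; lia.
  by rewrite -mulnA leq_mul2l leq_mul2r leq_mul ?orbT.
have L2 : (L < 2 ^ L)%N by rewrite ltn_expl.
lia.
Qed.

(** The first logarithm is at most [L + 1]. As [ln 2 <= 1], also [ln n <= L + 1 <= 2 ^ (K + 3)], so
    the second is at most [K + 3]. *)
Lemma log2_bounds_sum_le (R : realType) (n L K : nat) : (1 < n)%N ->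
  (n < 2 ^ L.+1)%N -> (L < 2 ^ (K + 3))%N ->
  log2 n%:R + log2 (ln n%:R) <= (K + L)%:R + 4 :> R.
Proof.
move=> n1 nL LK; have ln2 := @ln2_gt0 R; have n0 : (0 < n)%N by exact: ltnW.
have lnn : ln n%:R <= L.+1%:R * ln 2 :> R.
  rewrite mulr_natl -lnXn// ler_ln ?posrE ?exprn_gt0 ?ltr0n//.
  by rewrite -natrX ler_nat ltnW.
have lnn0 : 0 < ln n%:R :> R by rewrite ln_gt0// ltr1n.
have lnn2 : ln n%:R <= 2 ^+ (K + 3) :> R.
  apply: (le_trans lnn); apply: (@le_trans _ _ L.+1%:R).
    by rewrite ger_pMr// ln2_le1.
  by rewrite -natrX ler_nat.
have lnlnn : ln (ln n%:R) <= (K + 3)%:R * ln 2 :> R.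
  by rewrite mulr_natl -lnXn// ler_ln ?posrE ?exprn_gt0.
rewrite /log2 -mulrDl ler_pdivrMr// natrD.
move: lnn lnlnn; rewrite -natr1 natrD; lra.
Qed.

Theorem theorem52 (R : realType) :
  exists (C : R) (n0 : nat), forall n : nat, (n0 <= n)%N ->
  forall (d : measure_display) (Omega : measurableType d)
         (P : probability Omega R) (v0 : 'I_n)
         (call : nat -> 'I_n -> Omega -> 'I_n),
    pull_calls P call ->
    (`| (\int[P]_w spreading_time R v0 (fun t v => call t v w))
        - (log2 (n%:R : R) + log2 (ln (n%:R : R)))%:E | <= C%:E)%E.
Proof.
have ln2 := @ln2_gt0 R.
(* The deviation is at most [18 / ln 2 + 2] from above and [17 = 13 + 4] from below: the loss in the
   sum plus the rounding of the logarithms. *)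
exists (18 / ln 2 + 17), 16%N => n n16 d Omega P v0 call calls.
have n0 : (0 < n)%N by exact: leq_trans n16.
rewrite (expected_spreading_time calls).
pose p t : R := mean_after t (fun S => (S != [set: 'I_n]%SET)%:R) [set v0]%SET.
have p_ge0 t : (0 <= (p t)%:E)%E.
  rewrite lee_fin -[leLHS](mean_after_cst n0 t 0 [set v0]%SET).
  by apply: le_mean_after.
set mu := (\sum_(0 <= t <oo) _)%E; set l := log2 n%:R + log2 (ln n%:R).
have le_mu : (mu <= (l + (18 / ln 2 + 2))%:E)%E.
  apply: lime_le; first by apply: is_cvg_nneseries => t _ _; exact: p_ge0.
  apply: nearW => N; rewrite sumEFin lee_fin big_mkord.
  have n8 : (8 <= n)%N by exact: leq_trans n16.
  apply: (le_trans (sum_prob_uninformed_le n8 v0 N)).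
  by rewrite /l /log2; lra.
have ge_mu : ((l - 17)%:E <= mu)%E.
  pose L := trunc_log 2 n.
  have /andP[nL Ln] : (2 ^ L <= n < 2 ^ L.+1)%N by exact: trunc_log_bounds.
  have L4 : (4 <= L)%N by apply: trunc_log_max.
  (* The offset 2 yields [2 ^ (K + 2) <= L]; the subtraction does not truncate because [n >= 16]
     gives [L >= 4]. *)
  pose K := (trunc_log 2 L - 2)%N.
  have LK : (2 ^ (K + 2) <= L < 2 ^ (K + 3))%N.
    have : (2 <= trunc_log 2 L)%N by apply: trunc_log_max.
    rewrite (addnS K 2) /K => /subnK ->; apply: trunc_log_bounds => //.
    exact: leq_trans L4.
  apply: (le_trans _ (nneseries_lim_ge (K + L) (fun t _ _ => p_ge0 t))).
  rewrite sumEFin lee_fin big_mkord.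
  apply: (le_trans _ (sum_prob_uninformed_ge n0 v0 K L)).
  have loss := lower_bound_loss_le _ _ _ nL LK.
  have lossR : (2 * K%:R + 2 * 2 ^+ L + (K + L)%:R * K%:R * 4 ^+ (2 ^ K)) / n%:R
      <= 13 :> R.
    rewrite ler_pdivrMr ?ltr0n//.
    by move: loss; rewrite -(ler_nat R) natrD natrD !natrM !natrX.
  have /andP[_ LK3] := LK.
  have n1 : (1 < n)%N by exact: leq_trans n16.
  have := @log2_bounds_sum_le R n L K n1 Ln LK3.
  by rewrite -/l; lra.
have mu_fin : mu \is a fin_num.
  by rewrite fin_numE; apply/andP; split; apply/eqP => E;
    move: le_mu ge_mu; rewrite E.
move: le_mu ge_mu; rewrite -(fineK mu_fin) !lee_fin.
rewrite ler_norml => le_mu ge_mu.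
have : 0 < 18 / ln 2 :> R by rewrite divr_gt0.
by move=> ?; apply/andP; split; lra.
Qed.
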